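(* Let $\nu$ be an admissible profile, let $S^\nu$ be the associated sequence space with its natural topology $\tau$, and let $$p_0 := \min\Big(1,\ \inf_{\alpha:\,0\le\nu(\alpha)<1}\underline{\partial}^+\nu(\alpha)\Big).$$ Then: (1) if $p_0>0$, then $S^\nu$ is locally $p_0$-convex; (2) if $p_0<1$, then $S^\nu$ is not locally $p$-convex for any $p>p_0$ (where local $p$-convexity is defined for $0<p\le 1$).
   Context: Let $\mathbb{N}_0=\{0,1,2,\dots\}$, $\Lambda=\bigcup_{j\in\mathbb{N}_0}\{j\}\times\{0,\dots,2^j-1\}$ and $\Omega=\mathbb{C}^\Lambda$ with the topology of pointwise convergence. An admissible profile is a non-decreasing right-continuous function $\nu:\mathbb{R}\to\{-\infty\}\cup[0,1]$ that is not identically $-\infty$. The asymptotic profile of $x\in\Omega$ is $\nu_x(\alpha)=\lim_{\varepsilon\to0^+}\limsup_{j\to\infty}\frac{\log \#\{k:|x_{j,k}|\ge 2^{-(\alpha+\varepsilon)j}\}}{\log(2^j)}$ (with $\log 0=-\infty$), and $S^\nu=\{x\in\Omega:\nu_x(\alpha)\le\nu(\alpha)\ \forall\alpha\in\mathbb{R}\}$, which is a vector space. For $\alpha\in\mathbb{R}$ and $\beta\in\{-\infty\}\cup[0,+\infty)$ let $d_{\alpha,\beta}(x,y)=d_{\alpha,\beta}(x-y)$ with $d_{\alpha,\beta}(x)=\inf\{C\ge0:\ \forall j\in\mathbb{N}_0,\ \#\{k:|x_{j,k}|\ge C2^{-\alpha j}\}\le C2^{\beta j}\}$ (with $2^{\beta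 j}:=0$ if $\beta=-\infty$), and let $E(\alpha,\beta)=\{x\in\Omega:d_{\alpha,\beta}(x)<\infty\}$ with the metric $d_{\alpha,\beta}$. For any sequence $(\alpha_n)$ dense in $\mathbb{R}$ and any sequence $\varepsilon_m\searrow0$ of positive reals, $S^\nu=\bigcap_{n,m}E(\alpha_n,\nu(\alpha_n)+\varepsilon_m)$, and the topology $\tau$ of $S^\nu$ is the coarsest topology making all inclusions $S^\nu\subset E(\alpha_n,\nu(\alpha_n)+\varepsilon_m)$ continuous. It is known that $\tau$ does not depend on the choice of these sequences and makes $S^\nu$ a complete metrizable topological vector space. The right-inf derivative, where $\nu(\alpha)>-\infty$, is $\underline{\partial}^+\nu(\alpha)=\liminf_{h\to0^+}\frac{\nu(\alpha+h)-\nu(\alpha)}{h}$. Convention: $\inf\emptyset=+\infty$. For $0<p\le1$, a subset $K$ of a vector space is $p$-convex if $\sum_{n=1}^N\theta_nx_n\in K$ whenever $x_1,\dots,x_N\in K$ and $\theta_1,\dots,\theta_N\ge0$ satisfy $\sum_n\theta_n^p=1$; it is absolutely $p$-convex if moreover $\lambda x\in K$ whenever $x\in K$ and $\lambda\in\mathbb{C}$, $|\lambda|\le1$. A topological vector space is locally $p$-convex if it has a basis of absolutely $p$-convex neighbourhoods of $0$. *)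

(* Defs.v *)
From HB Require Import structures.
From mathcomp Require Import all_boot all_order all_algebra.
From mathcomp Require Import all_classical all_reals all_analysis.
From mathcomp Require Import complex ring.

Set Implicit Arguments.
Unset Strict Implicit.
Unset Printing Implicit Defensive.

Import Order.TTheory GRing.Theory Num.Theory.
Import numFieldTopology.Exports numFieldNormedType.Exports.

Local Open Scope classical_set_scope.
Local Open Scope complex_scope.
Local Open Scope ring_scope.

(* In \bar R, -oo is isolated in {-oo} `|` [0, 1]; hence right-continuity at a
   point where the value is -oo means being -oo on a right neighbourhood. *)
Record profile (R : realType) := Profile {
  profile_fun :> R -> \bar R ;
  profile_val : forall a, profile_fun a = -oo%E \/
                          (0 <= profile_fun a <= 1)%E ;
  profile_ndecr : {homo profile_fun : a b / a <= b >-> (a <= b)%E} ;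
  profile_rcont : forall a, profile_fun x @[x --> a^'+] --> profile_fun a ;
  profile_proper : exists a, profile_fun a != -oo%E }.

Definition Lambda := {j : nat & 'I_(2 ^ j)}.

Definition Omega (R : realType) := Lambda -> R[i].

Section sequence_spaces.
Variable R : realType.
Implicit Types (x y : Omega R) (a e t C w : R) (b : \bar R) (j n m : nat).

Definition count_ge x j t : nat :=
  #|[pred k : 'I_(2 ^ j) | t%:C <= `|x (existT _ j k)|]|.

(* the denominator vanishes at j = 0, a term that the limsup ignores *)
Definition log_count x a j : \bar R :=
  (lne (count_ge x j (2 `^ (- (a * j%:R))))%:R%:E / lne (2 ^+ j)%:E)%E.

Definition asymptotic_profile x a : \bar R :=
  lim (limn_esup (log_count x (a + e)) @[e --> 0^'+]).

Definition Sset (nu : R -> \bar R) : set (Omega R) :=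
  [set x | forall a, (asymptotic_profile x a <= nu a)%E].

(* 2 ^ (b * j), which is 0 for b = -oo, also at j = 0; b = +oo is not used *)
Definition pow2e b j : R :=
  if b == -oo%E then 0 else 2 `^ (fine b * j%:R).

Definition dist_set a b x : set R :=
  [set C | 0 <= C /\ forall j,
     (count_ge x j (C * 2 `^ (- (a * j%:R))))%:R <= C * pow2e b j].

Definition dist0 a b x : \bar R := ereal_inf (EFin @` dist_set a b x).

Definition Eset a b : set (Omega R) := [set x | (dist0 a b x < +oo)%E].

Lemma normcRe (z : R[i]) : `|z| = (complex.Re `|z|)%:C.
Proof. by rewrite complexRe; apply/esym/Creal_ReP; rewrite normr_real. Qed.

Lemma count_geP x j t u y : (forall k, u%:C <= `|y (existT _ j k)| ->
  t%:C <= `|x (existT _ j k)|) -> (count_ge y j u <= count_ge x j t)%N.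
Proof.
move=> h; apply: subset_leq_card; apply/fintype.subsetP => k.
by rewrite !inE; exact: h.
Qed.

Lemma count_ge_le x j t u : t <= u -> (count_ge x j u <= count_ge x j t)%N.
Proof. by move=> tu; apply: count_geP => k; apply: le_trans; rewrite lecR. Qed.

Lemma count_geD x y j t u :
  (count_ge (x + y)%R j (t + u)%R <= count_ge x j t + count_ge y j u)%N.
Proof.
rewrite -cardUI; apply: leq_trans (leq_addr _ _).
apply: subset_leq_card; apply/fintype.subsetP => k; rewrite !inE => h.
have [//|/negP xt] := boolP (t%:C <= `|x (existT _ j k)|).
apply: contraTT h => /negP yu.
suff : `|(x + y) (existT _ j k)| < (t + u)%:C.
  by move=> h; apply/negP => h'; have := lt_le_trans h h'; rewrite ltxx.
apply: le_lt_trans (ler_normD _ _) _; rewrite rmorphD/=.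
move/negP: xt; move/negP: yu; rewrite (normcRe (x _)) (normcRe (y _)) !lecR -!ltNge.
by move=> *; rewrite -!rmorphD/= ltcR ltrD.
Qed.

Lemma count_ge0 j t : 0 < t -> count_ge 0 j t = 0%N.
Proof.
move=> t0; apply: eq_card0 => k; rewrite !inE normr0.
by apply/negbTE; rewrite lecR -ltNge.
Qed.

Lemma count_geN x j t : count_ge (- x) j t = count_ge x j t.
Proof. by apply: eq_card => k; rewrite !inE normrN. Qed.

Lemma pow2_gt0 a : 0 < 2 `^ a :> R.
Proof. by rewrite powR_gt0. Qed.

Lemma pow2e_ge0 b j : 0 <= pow2e b j.
Proof. by rewrite /pow2e; case: ifP => // _; exact: powR_ge0. Qed.

Lemma dist_setD a b x y C D : dist_set a b x C -> dist_set a b y D ->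
  dist_set a b (x + y) (C + D).
Proof.
move=> [C0 hC] [D0 hD]; split=> [|j]; first exact: addr_ge0.
rewrite !mulrDl; apply: le_trans (lerD (hC j) (hD j)).
by rewrite -natrD ler_nat count_geD.
Qed.

Lemma dist0N a b x : dist0 a b (- x) = dist0 a b x.
Proof.
rewrite /dist0; congr ereal_inf; congr (_ @` _); apply/funext => C.
apply/propext; split=> -[C0 h]; split=> // j; have := h j;
  by rewrite count_geN.
Qed.

Lemma dist00 a b : dist0 a b 0 = 0%E.
Proof.
apply/eqP; rewrite eq_le; apply/andP; split; last first.
  by apply: le_ereal_inf_tmp => _ [C [C0 _] <-]; rewrite lee_fin.
apply/lee_addgt0Pr => e e0; rewrite add0e; apply: ereal_inf_lbound.
exists e => //; split=> [|j]; first exact: ltW.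
by rewrite count_ge0 ?mulr_gt0 ?pow2_gt0// mulr_ge0 ?pow2e_ge0// ltW.
Qed.

Lemma dist0_ge0 a b x : (0 <= dist0 a b x)%E.
Proof. by apply: le_ereal_inf_tmp => _ [C [C0 _] <-]; rewrite lee_fin. Qed.

Lemma dist0_fin a b x : Eset a b x -> dist0 a b x \is a fin_num.
Proof. by move=> h; rewrite ge0_fin_numE// dist0_ge0. Qed.

Lemma dist0_lt a b x e : (dist0 a b x < e%:E)%E ->
  exists2 C, C < e & dist_set a b x C.
Proof.
by move=> /ereal_inf_lt[_ [C hC <-]]; rewrite lte_fin; exists C.
Qed.

Lemma dist0_triangle a b x y :
  (dist0 a b (x + y)%R <= dist0 a b x + dist0 a b y)%E.
Proof.
have [hx|hx] := pselect (Eset a b x); last first.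
  rewrite /Eset/= in hx; move/negP: hx; rewrite -leNgt leye_eq => /eqP ->.
  by rewrite addye ?leey// gt_eqF// (lt_le_trans _ (dist0_ge0 _ _ _)) ?ltNyr.
have [hy|hy] := pselect (Eset a b y); last first.
  rewrite /Eset/= in hy; move/negP: hy; rewrite -leNgt leye_eq => /eqP ->.
  by rewrite addey ?leey// gt_eqF// (lt_le_trans _ (dist0_ge0 _ _ _)) ?ltNyr.
apply/lee_addgt0Pr => e e0.
have h2 z : Eset a b z -> exists2 C, (C%:E <= dist0 a b z + (e / 2)%:E)%E &
    dist_set a b z C.
  move=> hz; have [|C /ltW Ce dC] := @dist0_lt a b z (fine (dist0 a b z) + e / 2).
    by rewrite EFinD fineK ?dist0_fin// lteDl ?dist0_fin// lte_fin divr_gt0.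
  by exists C => //; move: Ce; rewrite -lee_fin EFinD fineK ?dist0_fin.
have [[C hC dC] [D hD dD]] := (h2 _ hx, h2 _ hy).
apply: (@le_trans _ _ (C%:E + D%:E)%E).
  by apply: ereal_inf_lbound; exists (C + D) => //; exact: dist_setD.
by apply: le_trans (leeD hC hD) _; rewrite addeACA -EFinD -splitr.
Qed.

Lemma EsetB a b x y : Eset a b x -> Eset a b y -> Eset a b (x - y).
Proof.
rewrite /Eset/= => hx hy; apply: le_lt_trans (dist0_triangle _ _ _ _) _.
by rewrite dist0N lte_add_pinfty.
Qed.

Lemma dist0_eq0 a b x : dist0 a b x = 0%E -> x = 0.
Proof.
move=> d0; apply/funext => -[j k]; apply/eqP; apply: contraT => xjk.
set r := complex.Re `|x (existT _ j k)|.
have r0 : 0 < r by rewrite -ltcR -normcRe normr_gt0.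
pose e := Num.min (r / 2 `^ (- (a * j%:R))) (1 / (1 + pow2e b j)).
have p0 : 0 < 1 + pow2e b j by rewrite ltr_pwDl ?pow2e_ge0.
have e0 : 0 < e by rewrite lt_min !divr_gt0 ?pow2_gt0.
have [|C Ce [C0 /(_ j)]] := @dist0_lt a b x e; first by rewrite d0 lte_fin.
have C1 : C * pow2e b j < 1.
  move: Ce; rewrite lt_min => /andP[_]; rewrite ltr_pdivlMr// mulrDr mulr1.
  by apply: le_lt_trans; rewrite lerDr.
move=> /le_lt_trans/(_ C1); rewrite -[ltRHS]/(1%:R).
rewrite ltr_nat ltnS leqn0 => /eqP/card0_eq/(_ k).
move: Ce; rewrite lt_min ltr_pdivlMr ?pow2_gt0// => /andP[/ltW Ce _].
by rewrite !inE normcRe lecR Ce.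
Qed.

Lemma log_ratio_le n j w : (0 < j)%N ->
  ((lne n%:R%:E / lne (2 ^+ j)%:E <= w%:E)%E = (n%:R <= 2 `^ (w * j%:R) :> R)).
Proof.
move=> j0; have lnj : 0 < ln (2 ^+ j : R) by rewrite ln_gt0// exprn_egt1 ?ltr1n// -lt0n.
have p2 : 0 < 2 ^+ j :> R by rewrite exprn_gt0.
have -> : (lne (2 ^+ j : R)%:E)%E = (ln (2 ^+ j : R))%:E by rewrite lne_EFin.
rewrite inver gt_eqF//; have [->|n0] := posnP n.
  rewrite le0_lneNy// powR_ge0 mulNyr gtr0_sg ?invr_gt0// mul1e.
  exact/leNye.
have nR0 : 0 < n%:R :> R by rewrite ltr0n.
rewrite lne_EFin// -EFinM lee_fin ler_pdivrMr// /powR pnatr_eq0/=.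
by rewrite -[in RHS](@lnK _ n%:R) ?posrE// ler_expR -mulrA -mulr_natl lnXn ?mulr_natl.
Qed.

Lemma log_count_ndecr x j : {homo (fun a => log_count x a j) :
  a c / a <= c >-> (a <= c)%E}.
Proof.
move=> a c ac; apply: lee_wpmul2r.
  by rewrite inve_ge0 lne_ge0 lee_fin exprn_ege1// ler1n.
have h : (count_ge x j (2 `^ (- (a * j%:R))) <=
    count_ge x j (2 `^ (- (c * j%:R))))%N.
  by apply: count_ge_le; rewrite ler_powR ?ler1n// lerN2 ler_wpM2r.
rewrite lee_lne ?lee_fin ?ler_nat//; by rewrite in_itv/= lee_fin ler0n leey.
Qed.

Lemma asymptotic_profileE x a : asymptotic_profile x a =
  ereal_inf [set limn_esup (log_count x (a + e)) | e in `]0, +oo[].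
Proof.
apply/cvg_lim; first exact: ereal_hausdorff.
pose f e := limn_esup (log_count x (a + e)).
apply: (@nondecreasing_at_right_cvge R f 0 +oo%O) => [//|e e' _ _ ee'].
apply: le_ereal_inf_tmp => _ [V V0 <-].
apply: (@le_trans _ _ (ereal_sup (log_count x (a + e)%R @` V))).
  by apply: ereal_inf_lbound; exists V.
apply: ge_ereal_sup => _ [j Vj <-].
apply: (@le_trans _ _ (log_count x (a + e')%R j)).
  by apply: log_count_ndecr; rewrite lerD2l.
by apply: ereal_sup_ubound; exists j.
Qed.

Lemma asymptotic_profile_leP x a b : (asymptotic_profile x a <= b)%E <->
  forall w, (b < w%:E)%E -> exists2 e, 0 < e &
    \forall j \near \oo,
      (count_ge x j (2 `^ (- ((a + e) * j%:R))))%:R <= 2 `^ (w * j%:R).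
Proof.
split=> [ab w bw|h].
  rewrite asymptotic_profileE in ab; have /ereal_inf_lt[_ [e + <-]] := le_lt_trans ab bw.
  rewrite /= in_itv/= andbT => e0 /ereal_inf_lt[_ [V V0 <-] /ltW Vw].
  exists e => //; have Vj : \forall j \near \oo, V j by exact: V0.
  near=> j; rewrite -log_ratio_le; last by near: j; exists 1%N.
  apply: le_trans Vw; apply: ereal_sup_ubound; exists j => //; near: j.
  exact: Vj.
have {}h w : (b < w%:E)%E -> (asymptotic_profile x a <= w%:E)%E.
  move=> /h[e e0 [N _ hN]]; rewrite asymptotic_profileE.
  apply: (@le_trans _ _ (limn_esup (log_count x (a + e)%R))).
    by apply: ereal_inf_lbound; exists e => //=; rewrite in_itv/= e0.
  apply: (@le_trans _ _ (ereal_sup (log_count x (a + e)%R @` [set j | (maxn N 1 <= j)%N]))).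
    apply: ereal_inf_lbound.
    by exists [set j | (maxn N 1 <= j)%N] => //; exists (maxn N 1).
  apply: ge_ereal_sup => _ [j/= Nj <-].
  by rewrite log_ratio_le ?hN//=; move: Nj; rewrite geq_max => /andP[].
case: b h => [r| |] h; last 2 first.
- exact: leey.
- by rewrite leeNy_eq; apply/eqP/eq_ninfty => w; apply: h; exact: ltNyr.
- by apply/lee_addgt0Pr => e e0; rewrite -EFinD; apply: h; rewrite lte_fin ltrDl.
Unshelve. all: by end_near. Qed.

Lemma near_pow2_ge C e : 0 < e -> \forall j \near \oo, C <= 2 `^ (e * j%:R).
Proof.
move=> e0; exists (Num.bound `|ln (`|C| + 1) / ln 2 / e|) => // j /= hj.
have C0 : 0 < `|C| + 1 by rewrite ltr_wpDl.
apply: (le_trans (ler_norm _)); apply: (@le_trans _ _ (`|C| + 1)).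
  by rewrite lerDl.
rewrite /powR pnatr_eq0/= -[leLHS](@lnK _ (`|C| + 1)) ?posrE// ler_expR.
rewrite -ler_pdivrMr ?ln_gt0 ?ltr1n// [leRHS]mulrC -ler_pdivrMr//.
apply: (le_trans (ler_norm _)); apply: le_trans (ltW (archi_boundP _)) _ => //.
by rewrite ler_nat.
Qed.

Lemma Re_norm_ge0 (z : R[i]) : 0 <= complex.Re `|z|.
Proof. by rewrite -lecR -normcRe; exact: normr_ge0. Qed.

Lemma pow2D a c : 2 `^ (a + c) = 2 `^ a * 2 `^ c :> R.
Proof. by rewrite powRD// pnatr_eq0 implybT. Qed.

Lemma pow2_half a e j : 2 `^ (- ((a + e / 2) * j%:R)) =
  2 `^ (e / 2 * j%:R) * 2 `^ (- ((a + e) * j%:R)) :> R.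
Proof. by rewrite -pow2D; congr (_ `^ _); field. Qed.

Lemma Sset_submod_closed (nu : R -> \bar R) :
  submod_closed [pred x | x \in Sset nu].
Proof.
have S0 : Sset nu 0.
  move=> a; apply/asymptotic_profile_leP => w _; exists 1 => //.
  by apply: nearW => j; rewrite count_ge0 ?powR_ge0// powR_gt0.
have SZ c x : Sset nu x -> Sset nu (c *: x).
  move=> Sx a; apply/asymptotic_profile_leP => w.
  have /asymptotic_profile_leP/(_ w) := Sx a; move=> /[apply] -[e e0 h].
  exists (e / 2); first by rewrite divr_gt0.
  have e2 : 0 < e / 2 by rewrite divr_gt0.
  have hc := near_pow2_ge (complex.Re `|c|) e2.
  apply: filterS2 h hc => j h hc; apply: le_trans h.
  rewrite ler_nat; apply: count_geP => k /=.
  have -> : `|(c *: x) (existT _ j k)| = `|c| * `|x (existT _ j k)|.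
    by rewrite -normrM.
  rewrite (normcRe c) (normcRe (x _)) -rmorphM/= !lecR pow2_half => h.
  rewrite -(@ler_pM2l _ (2 `^ (e / 2 * j%:R))) ?powR_gt0//.
  apply: (le_trans h); apply: ler_wpM2r; first exact: Re_norm_ge0.
  exact: hc.
have SD x y : Sset nu x -> Sset nu y -> Sset nu (x + y).
  move=> Sx Sy a; apply/asymptotic_profile_leP => w nuw.
  have [w' nuw' w'w] : exists2 w', (nu a < w'%:E)%E & w' < w.
    move: nuw; case: (nu a) => [r|//|_]; last first.
      by exists (w - 1); rewrite ?ltNyr// ltrBlDr ltrDl.
    by rewrite lte_fin => rw; exists ((r + w) / 2); rewrite ?lte_fin midf_lt.
  have /asymptotic_profile_leP/(_ w' nuw')[e1 e10 h1] := Sx a.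
  have /asymptotic_profile_leP/(_ w' nuw')[e2 e20 h2] := Sy a.
  pose e := Num.min e1 e2; have e0 : 0 < e by rewrite lt_min e10.
  have e2' : 0 < e / 2 by rewrite divr_gt0.
  exists (e / 2) => //.
  have hc := near_pow2_ge 2 e2'.
  have hw : \forall j \near \oo, 2 <= 2 `^ ((w - w') * j%:R) :> R.
    by apply: near_pow2_ge; rewrite subr_gt0.
  have hxy : \forall j \near \oo,
    (count_ge x j (2 `^ (- ((a + e) * j%:R))))%:R <= 2 `^ (w' * j%:R) /\
    (count_ge y j (2 `^ (- ((a + e) * j%:R))))%:R <= 2 `^ (w' * j%:R).
    apply: filterS2 h1 h2 => j h1 h2; split.
      apply: le_trans h1; rewrite ler_nat; apply: count_ge_le.
      by rewrite ler_powR ?ler1n// lerN2 ler_wpM2r// lerD2l ge_min lexx.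
    apply: le_trans h2; rewrite ler_nat; apply: count_ge_le.
    by rewrite ler_powR ?ler1n// lerN2 ler_wpM2r// lerD2l ge_min lexx orbT.
  apply: filterS3 hc hw hxy => j hc hw [hx hy].
  pose t : R := 2 `^ (- ((a + e) * j%:R)).
  have ht : t + t <= 2 `^ (- ((a + e / 2) * j%:R)).
    rewrite pow2_half -/t (_ : t + t = 2 * t); last by ring.
    by apply: ler_wpM2r => //; rewrite powR_ge0.
  have hn := leq_trans (count_ge_le (x + y) j ht) (count_geD x y j t t).
  apply: (@le_trans _ _ (2 * 2 `^ (w' * j%:R))).
    rewrite mulr_natl mulr2n; apply: le_trans (lerD hx hy).
    by rewrite -natrD ler_nat.
  have -> : w * j%:R = (w - w') * j%:R + w' * j%:R by ring.
  by rewrite pow2D ler_wpM2r// powR_ge0.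
split=> [|c x y /set_mem Sx /set_mem Sy]; first exact/mem_set.
by apply/mem_set; apply: SD; [exact: SZ|exact: Sy].
Qed.

Lemma Sset_sub_Eset (nu : profile R) a e : 0 < e ->
  Sset nu `<=` Eset a (nu a + e%:E)%E.
Proof.
move=> e0 x /(_ a) Sx.
suff [C hC] : exists C, dist_set a (nu a + e%:E)%E x C.
  by apply: (@le_lt_trans _ _ C%:E); rewrite ?ltry//; apply: ereal_inf_lbound; exists C.
(* an eventual bound with constant 1, completed by a bound on the first scales *)
have [J hJ] : exists J, forall j, (J <= j)%N ->
    (count_ge x j (2 `^ (- (a * j%:R))))%:R <= pow2e (nu a + e%:E)%E j.
  move/asymptotic_profile_leP: Sx.
  have leE e' j : 0 < e' -> (count_ge x j (2 `^ (- (a * j%:R))) <=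
      count_ge x j (2 `^ (- ((a + e') * j%:R))))%N.
    move=> e'0; apply: count_ge_le.
    by rewrite ler_powR ?ler1n// lerN2 ler_wpM2r// lerDl ltW.
  rewrite /pow2e; case: (profile_val nu a) => [->|/andP[n0 n1]].
    move=> /(_ (-1) (ltNyr _))[e' e'0 [J _ hJ]]; exists J.+1 => j Jj /=.
    have /hJ/= h : (J <= j)%N by exact: ltnW.
    suff: (count_ge x j (2 `^ (- (a * j%:R))))%:R < 1%:R :> R.
      by rewrite ltr_nat ltnS leqn0 => /eqP ->.
    apply: (@le_lt_trans _ _ (2 `^ (-1 * j%:R))).
      by apply: le_trans h; rewrite ler_nat leE.
    rewrite mulN1r powRN invf_lt1 ?pow2_gt0// powR_mulrn// exprn_egt1 ?ltr1n//.
    by rewrite -lt0n; exact: leq_trans Jj.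
  have nf : nu a \is a fin_num.
    by rewrite fin_numE; case: (nu a) n0 n1.
  move=> /(_ (fine (nu a) + e)) [|e' e'0 [J _ hJ]].
    by rewrite EFinD fineK// lteDl.
  exists J => j Jj; rewrite -(fineK nf) -EFinD/=.
  by apply: le_trans (hJ _ Jj); rewrite ler_nat leE.
have [M [M1 hM]] : exists M, 1 <= M /\ forall j, (j < J)%N -> forall k,
    complex.Re `|x (existT _ j k)| < M * 2 `^ (- (a * j%:R)).
  pose B j := \sum_(k < 2 ^ j) complex.Re `|x (existT _ j k)| / 2 `^ (- (a * j%:R)).

  have B0 j : 0 <= B j.
    by apply: sumr_ge0 => k _; rewrite divr_ge0 ?powR_ge0 ?Re_norm_ge0.
  exists (1 + \sum_(j < J) B j); split=> [|j jJ k].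
    by rewrite lerDl sumr_ge0.
  rewrite -ltr_pdivrMr ?pow2_gt0// ltr_pwDl//.
  rewrite (bigD1 (Ordinal jJ))//= (@le_trans _ _ (B j))//; last first.
    by rewrite lerDl sumr_ge0.
  rewrite /B (bigD1 k)//= lerDl sumr_ge0// => i _.
  by rewrite divr_ge0 ?powR_ge0 ?Re_norm_ge0.
have M0 : 0 <= M by exact: le_trans M1.
exists M; split=> // j; have [Jj|jJ] := leqP J j; last first.
  rewrite [count_ge _ _ _](_ : _ = 0%N) ?mulr_ge0 ?pow2e_ge0//.
  by apply: eq_card0 => k; rewrite !inE normcRe lecR leNgt hM.
apply: (@le_trans _ _ (pow2e (nu a + e%:E) j)); last first.
  by rewrite ler_peMl ?pow2e_ge0.
apply: le_trans (hJ _ Jj); rewrite ler_nat; apply: count_ge_le.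
by rewrite ler_peMl ?powR_ge0.
Qed.

End sequence_spaces.

(* the sequences (alpha_n) and (eps_m) that index the spaces
   E(alpha_n, nu(alpha_n) + eps_m) generating the topology of S^nu *)
Record grid (R : realType) := Grid {
  grid_alpha : nat -> R ;
  grid_eps : nat -> R ;
  grid_dense : dense (range grid_alpha) ;
  grid_eps_gt0 : forall m, 0 < grid_eps m ;
  grid_eps_nincr : {homo grid_eps : m n / (m <= n)%N >-> n <= m} ;
  grid_eps_cvg0 : grid_eps @ \oo --> (0 : R) }.

Record Espace (R : realType) (a : R) (b : \bar R) := MkE {
  Eval :> Omega R ;
  _ : Eval \in Eset a b }.

HB.instance Definition _ (R : realType) (a : R) (b : \bar R) :=
  [isSub for @Eval R a b].
HB.instance Definition _ (R : realType) (a : R) (b : \bar R) :=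
  [Choice of Espace a b by <:].

Section Espace_metric.
Context {R : realType} {a : R} {b : \bar R}.
Implicit Types u v : Espace a b.

Definition edist u v : R := fine (dist0 a b (val u - val v)).

Let Esub u v : Eset a b (val u - val v).
Proof. by apply: EsetB; apply/set_mem/valP. Qed.

Let edistxx u : edist u u = 0.
Proof. by rewrite /edist subrr dist00. Qed.

Let edist_positivity u v : edist u v = 0 -> u = v.
Proof.
move=> h; apply/val_inj/eqP; rewrite -subr_eq0; apply/eqP.
by apply: (@dist0_eq0 R a b); rewrite -(fineK (dist0_fin (Esub u v))) -/(edist u v) h.
Qed.

Let edist_sym u v : edist u v = edist v u.
Proof. by rewrite /edist -dist0N opprB. Qed.

Let edist_triangle v u w : edist u w <= edist u v + edist v w.
Proof.
have hf (u v : Espace a b) := dist0_fin (Esub u v).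
rewrite -lee_fin EFinD !fineK//; apply: le_trans (dist0_triangle _ _ _ _).
by rewrite addrA subrK.
Qed.

HB.instance Definition _ := isMetric.Build R (Espace a b)
  edistxx edist_positivity edist_sym edist_triangle.

End Espace_metric.

Definition Spred (R : realType) (nu : profile R) : {pred Omega R} :=
  [pred x | x \in Sset nu].

(* The elements and the linear structure of this type do not depend on [g],
   which is only used to define the topology. *)
Record Sspace (R : realType) (nu : profile R) (g : grid R) := MkS {
  Sval :> Omega R ;
  _ : Sval \in Spred nu }.

Section Sspace_structure.
Context {R : realType} {nu : profile R} {g : grid R}.

HB.instance Definition _ := [isSub for @Sval R nu g].
HB.instance Definition _ := [Choice of Sspace nu g by <:].
HB.instance Definition _ := GRing.isSubmodClosed.Build R[i] (Omega R)
  (Spred nu) (Sset_submod_closed nu).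
HB.instance Definition _ := [SubChoice_isSubLmodule of Sspace nu g by <:].

Lemma Sincl_subproof n m (x : Sspace nu g) :
  val x \in Eset (grid_alpha g n) (nu (grid_alpha g n) + (grid_eps g m)%:E)%E.
Proof. by apply/mem_set/Sset_sub_Eset/set_mem/valP/grid_eps_gt0. Qed.

Definition Sincl n m (x : Sspace nu g) :
    Espace (grid_alpha g n) (nu (grid_alpha g n) + (grid_eps g m)%:E)%E :=
  MkE (Sincl_subproof n m x).

(* the coarsest topology making all the inclusions [Sincl n m] continuous *)
HB.instance Definition _ := Topological.copy (Sspace nu g)
  (sup_topology (fun nm : nat * nat =>
     Topological.on (initial_topology (Sincl nm.1 nm.2)))).

End Sspace_structure.

Section local_pconvexity.
Context {R : realType}.

Definition pconvex_set (V : lmodType R[i]) (p : R) (K : set V) :=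
  forall N (theta : 'I_N -> R) (x : 'I_N -> V),
    (forall n, K (x n)) -> (forall n, 0 <= theta n) ->
    \sum_n theta n `^ p = 1 -> K (\sum_n (theta n)%:C *: x n).

Definition abs_pconvex_set (V : lmodType R[i]) (p : R) (K : set V) :=
  pconvex_set p K /\
  forall (l : R[i]) (x : V), K x -> `|l| <= 1 -> K (l *: x).

Definition locally_pconvex (V : preTopologicalLmodType R[i]) (p : R) :=
  forall U : set V, nbhs 0 U ->
    exists K : set V, [/\ nbhs 0 K, abs_pconvex_set p K & K `<=` U].

End local_pconvexity.

(* meant for [nu a] different from -oo *)
Definition right_inf_derivative (R : realType) (nu : R -> \bar R) (a : R) :
    \bar R :=
  limf_einf (fun h : R => (nu (a + h)%R - nu a) / h%:E)%E 0^'+.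

(* [fine] only forgets finiteness: difference quotients of [nu] are
   nonnegative where [nu] is not -oo, so the minimum lies in [0, 1]. *)
Definition critical_exponent (R : realType) (nu : profile R) : R :=
  fine (Order.min 1%E (ereal_inf
    [set right_inf_derivative nu a | a in [set a | (0 <= nu a < 1)%E]])).

(* Main.v *)
Require Import Defs.
From mathcomp Require Import all_boot all_order all_algebra.
From mathcomp Require Import all_classical all_reals all_analysis.
From mathcomp Require Import complex.
From mathcomp Require Import lra ring.

(** (1) Let p = p0 > 0 and 0 <= nu(alpha) < 1. Integrating the bound on the right
    derivative gives nu(b) <= nu(alpha) - p (alpha - b) for b < alpha as long as
    nu(b) is not -oo; in particular nu = -oo far to the left of alpha. Hence the
    coefficients of size at least c 2^(-alpha j) of an x close to 0 have p-th
    powers that sum up, at scale j, to at most a multiple of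
    2^((nu(alpha) - p alpha + eps) j). The sets of all y + z with
    |y_jk| <= c 2^(-alpha j) and sum_k |z_jk|^p bounded in this way are therefore
    neighbourhoods of 0; they are absolutely p-convex because t |-> t^p is
    subadditive, and by Chebyshev's inequality they are small for
    d_{alpha, nu(alpha) + eps}.

    (2) If p0 < p <= 1, then nu(a + h) < nu(a) + p h <= 1 for some a and h > 0.
    Cut a part of the scale j into about 2^(p h j) disjoint blocks of about
    2^(nu(a) j) indices. The sequences equal to 2^(-a j) on one block tend to 0
    with j, but their p-convex combination with equal weights takes the value
    2^(-(a + h) j) about 2^((nu(a) + p h) j) times, which is too often. *)

Set Implicit Arguments.
Unset Strict Implicit.
Unset Printing Implicit Defensive.

Import Order.TTheory GRing.Theory Num.Theory.
Import numFieldTopology.Exports numFieldNormedType.Exports.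

Local Open Scope classical_set_scope.
Local Open Scope complex_scope.
Local Open Scope ring_scope.

(** * Neighbourhoods of 0 in S^nu *)

Section topology.
Context {R : realType} {nu : profile R} {g : grid R}.
Local Notation S := (Sspace nu g).

Definition gball (nm : nat * nat) (r : R) : set S :=
  [set x | (dist0 (grid_alpha g nm.1)
    (nu (grid_alpha g nm.1) + (grid_eps g nm.2)%:E) (Sval x) < r%:E)%E].

Lemma ball_Sincl n m (x : S) r :
  ball (Sincl n m (0 : S)) r (Sincl n m x) <-> gball (n, m) r x.
Proof.
have hx : Eset (grid_alpha g n) (nu (grid_alpha g n) + (grid_eps g m)%:E)%E
    (Sval x) by apply/set_mem/Sincl_subproof.
by rewrite ballEmdist/= metric_sym /mdist/= /Defs.edist/= subr0
  -lte_fin fineK ?dist0_fin.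
Qed.

Lemma nbhs0_gball nm r : 0 < r -> nbhs (0 : S) (gball nm r).
Proof.
case: nm => n m r0; have : nbhs (0 : S) --> (0 : S) by exact: cvg_id.
move=> /cvg_sup/(_ (n, m)) h.
have /h : nbhs (0 : initial_topology (@Sincl R nu g n m))
  (Sincl n m @^-1` ball (Sincl n m (0 : S)) r).
  by apply: initial_continuous; exact: nbhsx_ballx.
by apply: filterS => x /= /ball_Sincl.
Qed.

(** The sets containing a finite intersection of [gball]s form a filter [F]. It converges to 0 in
    each initial topology, hence in their supremum. Taking minima of radii lets a single [r] serve
    for all of [s]. *)
Lemma nbhs0_gballP (U : set S) : nbhs 0 U ->
  exists (s : seq (nat * nat)) (r : R), 0 < r /\
    forall x : S, (forall nm, nm \in s -> gball nm r x) -> U x.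
Proof.
pose F : set_system S := [set V | exists (s : seq (nat * nat)) (r : R), 0 < r /\
  forall x : S, (forall nm, nm \in s -> gball nm r x) -> V x].
have FF : Filter F.
  split=> [|V W [s [r [r0 sr]]] [t [q [q0 tq]]]|V W VW [s [r [r0 sr]]]].
  - by exists [::], 1.
  - exists (s ++ t), (Num.min r q); split=> [|x h]; first by rewrite lt_min r0.
    split; [apply: sr|apply: tq] => nm nms.
      have := h nm; rewrite mem_cat nms => /(_ isT); rewrite /gball/= => /lt_le_trans; apply.
      by rewrite lee_fin ge_min lexx.
    have := h nm; rewrite mem_cat nms orbT => /(_ isT); rewrite /gball/= => /lt_le_trans; apply.
    by rewrite lee_fin ge_min lexx orbT.
  - by exists s, r; split=> // x /sr; exact: VW.
(* Convergence of [F] to 0 means by definition that every neighbourhood of 0 belongs to [F]. *)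
suff : F --> (0 : S) by exact.
apply/cvg_sup => -[n m] A [_ [[B oB <-] B0 BA]].
have /nbhs_ballP[r /= r0 rB] : nbhs (Sincl n m (0 : S)) B by exact: open_nbhs_nbhs.
exists [:: (n, m)], r; split=> // x /(_ (n, m)).
by rewrite inE eqxx => /(_ isT)/ball_Sincl/rB/BA.
Qed.

End topology.

(** * Absolutely p-convex sets at a single scale *)

Section scalewise.
Context {R : realType}.
Implicit Types (p s t : R) (j : nat) (x : Omega R).

Definition cnorm (z : R[i]) : R := complex.Re `|z|.

Lemma cnormE z : `|z| = (cnorm z)%:C.
Proof. exact: normcRe. Qed.

Lemma cnorm_ge0 z : 0 <= cnorm z.
Proof. exact: Re_norm_ge0. Qed.

Lemma cnorm0 : cnorm 0 = 0.
Proof. by rewrite /cnorm normr0. Qed.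

Lemma cnormM z w : cnorm (z * w) = cnorm z * cnorm w.
Proof. by apply: (@complexI R); rewrite rmorphM/= -!cnormE normrM. Qed.

Lemma cnorm_real t : 0 <= t -> cnorm t%:C = t.
Proof. by move=> t0; apply: (@complexI R); rewrite -cnormE ger0_norm// lecR. Qed.

Lemma ler_cnormD z w : cnorm (z + w) <= cnorm z + cnorm w.
Proof. by rewrite -lecR rmorphD/= -!cnormE ler_normD. Qed.

Lemma ler_cnorm_sum (I : finType) (z : I -> R[i]) :
  cnorm (\sum_i z i) <= \sum_i cnorm (z i).
Proof.
elim/big_ind2 : _ => [|u v u' v' h h'|//]; first by rewrite cnorm0.
exact: le_trans (ler_cnormD _ _) (lerD h h').
Qed.

Lemma le_powR_unit p t : 0 < p -> p <= 1 -> 0 <= t <= 1 -> t <= t `^ p.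
Proof.
move=> p0 p1 /andP[]; rewrite le_eqVlt => /predU1P[<- _|t0 t1].
  exact: powR_ge0.
by rewrite -[leLHS]powRr1 ?(ltW t0)// ger_powR// t0.
Qed.

(** For [u] equal to [s] or [t], the ratio [u / (s + t)] lies in [0, 1], so it is at most its p-th
    power. Multiplying by (s + t)^p and adding the two bounds gives the claim. *)
Lemma powR_subadditive p s t : 0 < p -> p <= 1 -> 0 <= s -> 0 <= t ->
  (s + t) `^ p <= s `^ p + t `^ p.
Proof.
move=> p0 p1 s0 t0; have [st0|st0] := leP (s + t) 0.
  rewrite (_ : s + t = 0); last by lra.
  by rewrite powR0 ?gt_eqF// addr_ge0 ?powR_ge0.
have h u : 0 <= u -> u <= s + t -> u / (s + t) * (s + t) `^ p <= u `^ p.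
  move=> u0 ust; rewrite -[in leRHS](@divfK _ (s + t) _ u) ?gt_eqF//.
  rewrite powRM ?divr_ge0// ?(ltW st0)// ler_wpM2r ?powR_ge0// le_powR_unit//.
  by rewrite divr_ge0 ?(ltW st0)//= ler_pdivrMr// mul1r.
apply: le_trans (lerD (h s s0 _) (h t t0 _)); last 2 first.
- by rewrite lerDl.
- by rewrite lerDr.
by rewrite -mulrDl -mulrDl divff ?gt_eqF// mul1r.
Qed.

Lemma powR_sum_le p (I : finType) (f : I -> R) : 0 < p -> p <= 1 ->
  (forall i, 0 <= f i) -> (\sum_i f i) `^ p <= \sum_i f i `^ p.
Proof.
move=> p0 p1 f0.
suff [] : 0 <= \sum_i f i /\ (\sum_i f i) `^ p <= \sum_i f i `^ p by [].
elim/big_ind2 : _ => [|u v u' v' [u0 h] [u'0 h']|i _].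
- by rewrite powR0 ?gt_eqF.
- split; first exact: addr_ge0.
  exact: le_trans (powR_subadditive p0 p1 u0 u'0) (lerD h h').
- by split.
Qed.

Lemma sum_weights_le1 p (I : finType) (theta : I -> R) : 0 < p -> p <= 1 ->
  (forall n, 0 <= theta n) -> \sum_n theta n `^ p = 1 -> \sum_n theta n <= 1.
Proof.
move=> p0 p1 th0 th1; rewrite -[leRHS]th1; apply: ler_sum => n _.
apply: le_powR_unit => //; rewrite th0/= leNgt; apply/negP => th.
suff : 1 < theta n `^ p.
  apply/negP; rewrite -leNgt -th1 (bigD1 n)//= lerDl.
  by apply: sumr_ge0 => i _; exact: powR_ge0.
by have := gt0_ltr_powR p0; move/(_ 1 (theta n)); rewrite powR1; apply;
  rewrite ?nnegrE ?ler01.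
Qed.

(** The sum of a sup-norm ball and an l^p ball at the scale [j]. Here [t] bounds the p-th power of
    the l^p quasi-norm, which is the quantity that behaves additively. *)
Definition split_ball p j s t : set (Omega R) :=
  [set x | exists y z : 'I_(2 ^ j) -> R[i],
    [/\ forall k, x (existT _ j k) = y k + z k,
        forall k, cnorm (y k) <= s & \sum_k cnorm (z k) `^ p <= t]].

(** The parts [y] keep their bound because the weights sum to at most 1. The parts [z] keep theirs
    by subadditivity of the p-th power, after exchanging the sums over [k] and [n]. *)
Lemma split_ball_pconvex p j s t (I : finType) (theta : I -> R)
    (x : I -> Omega R) : 0 < p -> p <= 1 ->
  (forall n, split_ball p j s t (x n)) -> (forall n, 0 <= theta n) ->
  \sum_n theta n `^ p = 1 -> split_ball p j s t (\sum_n (theta n)%:C *: x n).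
Proof.
move=> p0 p1 hx th0 th1.
have /choice[y /choice[z hyz]] := hx.
exists (fun k => \sum_n (theta n)%:C * y n k),
  (fun k => \sum_n (theta n)%:C * z n k); split=> [k|k|].
- rewrite fct_sumE -big_split/=; apply: eq_bigr => n _.
  have [xyz _ _] := hyz n.
  by rewrite -mulrDr -xyz.
(* Weights over an empty index set would sum to 0, so some [x n] exists and its part [y n] witnesses
   the sign of [s]. *)
- have s0 : 0 <= s.
    have [n _|I0] := pickP (xpredT : pred I).
      by have [_ /(_ k) h _] := hyz n; exact: le_trans (cnorm_ge0 _) h.
    by move: th1 => /eqP; rewrite big_pred0// eq_sym oner_eq0.
  apply: le_trans (ler_cnorm_sum _) _; apply: (@le_trans _ _ (\sum_n theta n * s)).
    apply: ler_sum => n _; rewrite cnormM cnorm_real//.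
    by apply: ler_wpM2l => //; have [_ /(_ k) h _] := hyz n.
  by rewrite -mulr_suml ler_piMl// (sum_weights_le1 p0 p1).
- apply: (@le_trans _ _ (\sum_k \sum_n theta n `^ p * cnorm (z n k) `^ p)).
    apply: ler_sum => k _.
    apply: (@le_trans _ _ ((\sum_n theta n * cnorm (z n k)) `^ p)).
      apply: ge0_ler_powR; rewrite ?nnegrE ?(ltW p0) ?cnorm_ge0//.
        by apply: sumr_ge0 => n _; rewrite mulr_ge0 ?cnorm_ge0.
      apply: le_trans (ler_cnorm_sum _) _; apply: ler_sum => n _.
      by rewrite cnormM cnorm_real.
    apply: le_trans (powR_sum_le p0 p1 _) _ => [n|].
      by rewrite mulr_ge0 ?cnorm_ge0.
    by apply: ler_sum => n _; rewrite powRM ?cnorm_ge0.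
  rewrite exchange_big/= -[leRHS]mul1r -th1 mulr_suml; apply: ler_sum => n _.
  by rewrite -mulr_sumr ler_wpM2l ?powR_ge0//; have [] := hyz n.
Qed.

Lemma split_ball_balanced p j s t (l : R[i]) x : 0 < p ->
  split_ball p j s t x -> `|l| <= 1 -> split_ball p j s t (l *: x).
Proof.
move=> p0 [y [z [xyz ys zt]]] l1.
have {}l1 w : cnorm (l * w) <= cnorm w.
  rewrite cnormM ler_piMl ?cnorm_ge0//.
  by move: l1; rewrite cnormE -[1]/(1%:C) lecR.
exists (fun k => l * y k), (fun k => l * z k); split=> [k|k|].
- by rewrite -mulrDr -xyz.
- exact: le_trans (l1 _) (ys k).
- apply: le_trans zt; apply: ler_sum => k _.
  by apply: ge0_ler_powR; rewrite ?nnegrE ?(ltW p0) ?cnorm_ge0.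
Qed.

End scalewise.

Section scalewise_S.
Context {R : realType} {nu : profile R} {g : grid R}.
Local Notation S := (Sspace nu g).

Lemma SvalZ (l : R[i]) (x : S) : Sval (l *: x) = l *: Sval x.
Proof. reflexivity. Qed.

(** The set [D] selects the constrained scales: all of them where nu(alpha) < 1, finitely many where
    nu(alpha) = 1. *)
Lemma split_ball_abs_pconvex p (D : set nat) (s t : nat -> R) :
  0 < p -> p <= 1 ->
  abs_pconvex_set p
    [set x : S | forall j, D j -> split_ball p j (s j) (t j) (Sval x)].
Proof.
move=> p0 p1; split=> [N theta x hx th0 th1 j Dj|l x hx l1 j Dj].
  have -> : Sval (\sum_n (theta n)%:C *: x n) = \sum_n (theta n)%:C *: Sval (x n).
    rewrite -[LHS]/(val _) raddf_sum; apply: eq_bigr => n _.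
    exact: SvalZ.
  by apply: split_ball_pconvex => // n; exact: hx.
rewrite SvalZ; apply: split_ball_balanced => //; exact: hx.
Qed.

End scalewise_S.

(** * Slope of the profile and the critical exponent *)

Section slope.
Context {R : realType}.
Implicit Types (nu : profile R) (p q a b h e : R).

Lemma profile_fin nu a : (0 <= nu a)%E -> nu a \is a fin_num.
Proof.
by case: (profile_val nu a) => [->//|/andP[n0 n1] _]; case: (nu a) n0 n1.
Qed.

Lemma profile_ge0_homo nu a b : (0 <= nu a)%E -> a <= b -> (0 <= nu b)%E.
Proof. by move=> na ab; apply: le_trans na _; exact: profile_ndecr. Qed.

Lemma fine_profile_homo nu a b : (0 <= nu a)%E -> a <= b ->
  fine (nu a) <= fine (nu b).
Proof.
move=> na ab; apply: fine_le; rewrite ?profile_fin//; last exact: profile_ndecr.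
exact: profile_ge0_homo ab.
Qed.

Lemma difference_quotientE nu a h : (0 <= nu a)%E -> 0 < h ->
  ((nu (a + h)%R - nu a) / h%:E)%E =
  ((fine (nu (a + h)) - fine (nu a)) / h)%:E.
Proof.
move=> na h0; have nah : (0 <= nu (a + h)%R)%E.
  by apply: profile_ge0_homo na _; rewrite lerDl ltW.
rewrite inver gt_eqF// -{1}(fineK (profile_fin nah)) -{1}(fineK (profile_fin na)).
by rewrite -EFinB -EFinM.
Qed.

Lemma right_inf_derivative_gt nu q a : (0 <= nu a)%E ->
  (q%:E < right_inf_derivative nu a)%E ->
  exists2 d, 0 < d & forall h, 0 < h < d ->
    fine (nu a) + q * h <= fine (nu (a + h)).
Proof.
move=> na; rewrite /right_inf_derivative limf_einfE.
move=> /ereal_sup_gt[_ [V V0 <-]] qV.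
have {}V0 : \forall h \near 0^'+, V h by exact: V0.
move: V0 => -[d /= d0 dV]; exists d => // h /andP[h0 hd].
have Vh : V h.
  by apply: dV => //=; rewrite sub0r normrN gtr0_norm.
have := lt_le_trans qV (ereal_inf_lbound (imageP _ Vh)).
rewrite difference_quotientE// lte_fin ltr_pdivlMr// ltrBrDl => /ltW.
by rewrite addrC.
Qed.

Lemma right_inf_derivative_lt nu q a e : (0 <= nu a)%E -> 0 < e ->
  (right_inf_derivative nu a < q%:E)%E ->
  exists2 h, 0 < h < e & fine (nu (a + h)) < fine (nu a) + q * h.
Proof.
move=> na e0; rewrite /right_inf_derivative limf_einfE => hq.
pose V := [set h : R | 0 < h < e].
have V0 : 0^'+ V.
  exists e => // h /=; rewrite sub0r normrN => /ltr_normlP[_ he] h0.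
  by apply/andP.
have /ereal_inf_lt[_ [h /= /andP[h0 he] <-]] := le_lt_trans (ereal_sup_ubound (imageP _ V0)) hq.
rewrite difference_quotientE// lte_fin ltr_pdivrMr// ltrBlDl => hh.
by exists h => //; rewrite h0.
Qed.

(** For a slope [q < p], let [A] be the set of points of [a, b] where the bound from [a] holds. It
    contains its supremum by monotonicity of [nu]. If [sup A < b], the right derivative there
    exceeds [q], so the bound extends beyond [sup A], a contradiction. Finally [q] tends to [p]. *)
Lemma profile_slope nu p a b :
  (forall c, (0 <= nu c < 1)%E -> (p%:E <= right_inf_derivative nu c)%E) ->
  a <= b -> (0 <= nu a)%E -> (nu b < 1)%E ->
  fine (nu a) + p * (b - a) <= fine (nu b).
Proof.
move=> hp ab na nb; pose f x := fine (nu x).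
have [->|anb] := eqVneq a b; first by rewrite subrr mulr0 addr0.
have ba0 : 0 < b - a by rewrite subr_gt0 lt_neqAle anb.
have nx x : a <= x -> (0 <= nu x)%E by exact: profile_ge0_homo.
suff hq q : q < p -> f a + q * (b - a) <= f b.
  apply/ler_addgt0Pr => e e0.
  have := hq (p - e / (b - a)).
  rewrite ltrBlDr ltrDl divr_gt0// => /(_ isT).
  by rewrite mulrBl divfK ?gt_eqF// addrA lerBlDr.
move=> qp; have [q0|q0] := leP q 0.
  apply: (@le_trans _ _ (f a)); last exact: fine_profile_homo.
  by rewrite gerDl mulr_le0_ge0// ltW.
pose A := [set x | a <= x <= b /\ f a + q * (x - a) <= f x].
have Aa : A a by split; rewrite ?lexx// subrr mulr0 addr0.
have supA : has_sup A.
  by split; [exists a|exists b => x [/andP[]]].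
have sa : a <= sup A by apply: ub_le_sup => //; exact: supA.2.
have sb : sup A <= b by apply: ge_sup; [exists a|move=> x [/andP[]]].
(* Solved for [x], the bound becomes an upper bound of [A] and so passes to the supremum. This
   divides by [q], hence the separate case [q <= 0]. *)
have As : f a + q * (sup A - a) <= f (sup A).
  suff : sup A <= a + (f (sup A) - f a) / q.
    by rewrite -lerBlDl ler_pdivlMr// mulrC lerBrDl.
  apply: ge_sup => [|x Ax]; first by exists a.
  rewrite -lerBlDl ler_pdivlMr// mulrC lerBrDl.
  case: (Ax) => /andP[ax _] /le_trans; apply; apply: fine_profile_homo (nx _ ax) _.
  by apply: ub_le_sup => //; exact: supA.2.
move: sb; rewrite le_eqVlt => /predU1P[<-//|sb].
have [d d0 hd] : exists2 d, 0 < d & forall h, 0 < h < d ->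
    fine (nu (sup A)) + q * h <= fine (nu (sup A + h)).
  apply: right_inf_derivative_gt; first exact: nx.
  apply: lt_le_trans (hp _ _); first by rewrite lte_fin.
  by rewrite nx//= (le_lt_trans _ nb)// profile_ndecr// ltW.
pose h := Num.min (d / 2) (b - sup A).
have h0 : 0 < h by rewrite lt_min divr_gt0// subr_gt0.
have hh : 0 < h < d by rewrite h0/= gt_min ltr_pdivrMr// ltr_pMr// ltr1n.
have : A (sup A + h).
  split; first rewrite (le_trans sa) ?lerDl ?(ltW h0)//= -lerBrDl ge_min lexx orbT//.
  apply: le_trans (hd _ hh); apply: le_trans (lerD As (lexx (q * h))).
  by rewrite [leLHS](_ : _ = f a + q * (sup A - a) + q * h)//; ring.
move=> /(ub_le_sup supA.2); rewrite gerDl => /le_lt_trans/(_ h0).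
by rewrite ltxx.
Qed.

Lemma right_inf_derivative_ge_critical nu a : 0 < critical_exponent nu ->
  (0 <= nu a < 1)%E ->
  ((critical_exponent nu)%:E <= right_inf_derivative nu a)%E.
Proof.
rewrite /critical_exponent; set m := Order.min _ _ => m0 na.
(* [fine] sends infinite values to 0, so [m0] forces [m] to be finite. *)
have -> : (fine m)%:E = m.
  by apply: fineK; move: m0; case: m => [//|/=|/=]; rewrite ltxx.
rewrite /m ge_min; apply/orP; right; apply: ereal_inf_lbound.
by exists a.
Qed.

Lemma critical_exponent_le1 nu : critical_exponent nu <= 1.
Proof.
rewrite /critical_exponent; set m := Order.min _ _.
have : (m <= 1)%E by rewrite /m ge_min lexx.
by case: m => [r|//|_] /=.
Qed.

(** Since [p <= 1], a minimum below [p] must come from the infimum, and some term of the infimum is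
    then below [p]. *)
Lemma right_inf_derivative_lt_critical nu p :
  critical_exponent nu < p -> p <= 1 ->
  exists2 a, (0 <= nu a < 1)%E & (right_inf_derivative nu a < p%:E)%E.
Proof.
rewrite /critical_exponent; set m := Order.min _ _ => mp p1.
have : (m < p%:E)%E.
  have : (m <= 1)%E by rewrite /m ge_min lexx.
  by case: m mp => [r|//|_ _] //=; exact: ltNyr.
rewrite /m gt_min => /orP[|/ereal_inf_lt[_ [a na <-] ap]]; last by exists a.
by rewrite lte_fin ltNge p1.
Qed.

End slope.

(** * Coefficient counts and split balls *)

Section neighbourhoods.
Context {R : realType}.
Implicit Types (p s t a c r : R) (b : \bar R) (j : nat) (x : Omega R).

Lemma in_count_ge t x j (k : 'I_(2 ^ j)) :
  (t%:C <= `|x (existT _ j k)|) = (t <= cnorm (x (existT _ j k))).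
Proof. by rewrite cnormE lecR. Qed.

Lemma count_ge_eq0P x j t : count_ge x j t = 0%N <->
  forall k, cnorm (x (existT _ j k)) < t.
Proof.
split=> [/card0_eq h k|h]; last first.
  by apply: eq_card0 => k; rewrite !inE in_count_ge leNgt h.
by have := h k; rewrite !inE in_count_ge ltNge => ->.
Qed.

Lemma count_ge_sum x j t (c : R) :
  (count_ge x j t)%:R * c = \sum_(k < 2 ^ j | t <= cnorm (x (existT _ j k))) c.
Proof.
rewrite sumr_const mulr_natl; congr (_ *+ _); apply: eq_card => k.
by rewrite !inE in_count_ge.
Qed.

Lemma dist0_lt_count a b x r : (dist0 a b x < r%:E)%E -> forall j,
  (count_ge x j (r * 2 `^ (- (a * j%:R))))%:R <= r * pow2e b j.
Proof.
move=> /dist0_lt[C Cr [C0 hC]] j.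
apply: (@le_trans _ _ (C * pow2e b j)); last first.
  by apply: ler_wpM2r; [exact: pow2e_ge0|exact: ltW].
apply: le_trans (hC j); rewrite ler_nat; apply: count_ge_le.
by apply: ler_wpM2r; [exact: powR_ge0|exact: ltW].
Qed.

Lemma dist0_le a b x c : 0 <= c ->
  (forall j, (count_ge x j (c * 2 `^ (- (a * j%:R))))%:R <= c * pow2e b j) ->
  (dist0 a b x <= c%:E)%E.
Proof. by move=> c0 h; apply: ereal_inf_lbound; exists c. Qed.

(** Where |x| >= 2s, the bound |y| <= s leaves |z| >= s; Chebyshev's inequality then applies to
    [z]. *)
Lemma split_ball_chebyshev p j s t x : 0 < p -> 0 < s ->
  split_ball p j s t x -> (count_ge x j (2 * s))%:R * s `^ p <= t.
Proof.
move=> p0 s0 [y [z [xyz ys zt]]]; apply: le_trans zt.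
rewrite count_ge_sum big_mkcond/=; apply: ler_sum => k _.
case: ifPn => [|_]; last exact: powR_ge0.
rewrite xyz => h; apply: ge0_ler_powR; rewrite ?nnegrE ?(ltW p0) ?(ltW s0) ?cnorm_ge0//.
have := ler_cnormD (y k) (z k); have := ys k; lra.
Qed.

Lemma split_ball_sup p j s x : 0 < p ->
  (forall k, cnorm (x (existT _ j k)) <= s) -> forall t, 0 <= t ->
  split_ball p j s t x.
Proof.
move=> p0 hx t t0; exists (fun k => x (existT _ j k)), (fun=> 0).
split=> // [k|]; first by rewrite addr0.
by rewrite big1// => k _; rewrite cnorm0 powR0// gt_eqF.
Qed.

Lemma crossing (f : nat -> R) N t : f 0%N <= t -> t < f N ->
  exists2 i : 'I_N, f i <= t & t < f i.+1.
Proof.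
move=> f0; elim: N => [|N IH]; first by rewrite ltNge f0.
move=> tN; have [fN|/IH[i fi tfi]] := leP (f N) t; first by exists ord_max.
by exists (widen_ord (leqnSn N) i).
Qed.

(* The coefficients of size at least [c 2^(-b_0 j)] are sorted by the levels
   [eta 2^(-b_i j)] and estimated on each level by count times maximal size. *)
Lemma split_ball_levels p j c eta t (b : nat -> R) (w : nat -> R) N x :
  0 < p -> 0 <= eta -> eta <= c ->
  (forall k, cnorm (x (existT _ j k)) < eta * 2 `^ (- (b N * j%:R))) ->
  (forall i : 'I_N, (count_ge x j (eta * 2 `^ (- (b i * j%:R))))%:R <= w i) ->
  \sum_(i < N) w i * (eta * 2 `^ (- (b i.+1 * j%:R))) `^ p <= t ->
  split_ball p j (c * 2 `^ (- (b 0%N * j%:R))) t x.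
Proof.
move=> p0 eta0 etac xN xw wt.
pose f i := eta * 2 `^ (- (b i * j%:R)); pose u k := cnorm (x (existT _ j k)).
pose big k := f 0%N <= u k.
exists (fun k => if big k then 0 else x (existT _ j k)),
  (fun k => if big k then x (existT _ j k) else 0); split=> [k|k|].
- by case: ifP; rewrite ?add0r ?addr0.
- case: ifPn; first by rewrite cnorm0 mulr_ge0 ?powR_ge0// (le_trans eta0).
  rewrite -ltNge => /ltW/le_trans; apply.
  by apply: ler_wpM2r => //; exact: powR_ge0.
(* A big coefficient lies between [f i] and [f i.+1] for some [i], so the i-th summand alone
   dominates its p-th power. Exchanging the sums turns the conditions [f i <= u k] into counts. *)
- apply: le_trans wt; apply: (@le_trans _ _
      (\sum_k \sum_(i < N) if f i <= u k then f i.+1 `^ p else 0)).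
    apply: ler_sum => k _.
    have ge0 (i : 'I_N) : 0 <= if f i <= u k then f i.+1 `^ p else 0.
      by case: ifP => // _; exact: powR_ge0.
    case: ifPn => [bk|_]; last by rewrite cnorm0 powR0 ?gt_eqF// sumr_ge0.
    have [i fi ui] := crossing bk (xN k).
    rewrite (bigD1 i)//= fi; apply: (@le_trans _ _ (f i.+1 `^ p)); last first.
      by rewrite lerDl; apply: sumr_ge0.
    by apply: ge0_ler_powR; rewrite ?nnegrE ?(ltW p0) ?cnorm_ge0 ?mulr_ge0 ?powR_ge0// ltW.
  rewrite exchange_big/=; apply: ler_sum => i _.
  rewrite -big_mkcond/= -count_ge_sum; apply: ler_wpM2r; first exact: powR_ge0.
  exact: xw.
Qed.

End neighbourhoods.

(** * Local convexity from a lower bound on the slope *)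

Section local_convexity.
Context {R : realType} {nu : profile R} {g : grid R}.
Local Notation S := (Sspace nu g).
Implicit Types (p c r d e : R) (n m i j : nat).

Lemma grid_between a b : a < b -> exists n, a < grid_alpha g n < b.
Proof.
move=> ab; have [||y [/= aby [n _ ny]]] := @grid_dense R g `]a, b[%classic.
- by exists ((a + b) / 2); rewrite /= in_itv/= !midf_lt.
- exact: interval_open.
by exists n; rewrite ny; move: aby; rewrite in_itv.
Qed.

Lemma grid_eps_lt d : 0 < d -> exists m, grid_eps g m < d.
Proof.
move=> d0; have /cvgrPdist_lt/(_ _ d0)[m _ /(_ m (leqnn m))] := @grid_eps_cvg0 R g.
by rewrite sub0r normrN gtr0_norm ?grid_eps_gt0//; exists m.
Qed.

Lemma pow2eE b j : b \is a fin_num -> pow2e b j = 2 `^ (fine b * j%:R) :> R.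
Proof. by rewrite /pow2e; case: b. Qed.

Lemma pow2e_profile a e j : (0 <= nu a)%E ->
  pow2e (nu a + e%:E) j = 2 `^ ((fine (nu a) + e) * j%:R) :> R.
Proof. by move=> na; rewrite pow2eE ?fin_numD ?fineD ?profile_fin. Qed.

Lemma pow2eNy j : pow2e -oo j = 0 :> R.
Proof. by rewrite /pow2e eqxx. Qed.

(** The l^p bound is the count allowed by d_{alpha, nu(alpha) + eps} times the p-th power of the
    threshold, so Chebyshev's inequality gives back exactly that count. The trivial condition
    [setT j] matches the form of [split_ball_abs_pconvex]. *)
Definition split_nbhs n m p c : set S :=
  [set x : S | forall j, setT j ->
    split_ball p j (c * 2 `^ (- (grid_alpha g n * j%:R)))
      (c * pow2e (nu (grid_alpha g n) + (grid_eps g m)%:E)%E j *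
       (c * 2 `^ (- (grid_alpha g n * j%:R))) `^ p) (Sval x)].

Lemma split_nbhs_gball n m p c r : 0 < p -> 0 < c -> 2 * c < r ->
  split_nbhs n m p c `<=` gball (n, m) r.
Proof.
move=> p0 c0 cr x hx; rewrite /gball/=.
apply: (@le_lt_trans _ _ (2 * c)%:E); last by rewrite lte_fin.
apply: dist0_le => [|j]; first by rewrite mulr_ge0// ltW.
set a := grid_alpha g n; set b := (nu a + _)%E.
have u0 : 0 < c * 2 `^ (- (a * j%:R)) by rewrite mulr_gt0// powR_gt0.
have := split_ball_chebyshev p0 u0 (hx j I).
rewrite ler_pM2r ?powR_gt0// mulrA => /le_trans; apply.
by apply: ler_wpM2r; [exact: pow2e_ge0|rewrite ler_peMl ?ler1n// ltW].
Qed.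

Lemma nbhs0_split_nbhs_Ny n m p c : 0 < p -> 0 < c ->
  nu (grid_alpha g n) = -oo%E ->
  nbhs (0 : S) (split_nbhs n m p c).
Proof.
move=> p0 c0 na; apply: filterS (nbhs0_gball (n, m) c0) => x /dist0_lt_count hx j _.
apply: split_ball_sup => //; last by rewrite !mulr_ge0 ?powR_ge0 ?pow2e_ge0 ?ltW.
move=> k; apply/ltW; apply: (count_ge_eq0P _ _ _).1 k.
by apply/eqP; have := hx j; rewrite /= na pow2eNy mulr0 lern0.
Qed.

(** Grid points [b i] descend from [alpha_n] until the profile is -oo. The slope bound makes count
    times size^p on each level at most a multiple of 2^((nu(a) - p a + e) j), so finitely many
    [gball]s suffice. *)
Lemma nbhs0_split_nbhs_fin n m p c : 0 < p -> p <= 1 -> 0 < c ->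
  (forall a, (0 <= nu a < 1)%E -> (p%:E <= right_inf_derivative nu a)%E) ->
  (0 <= nu (grid_alpha g n) < 1)%E ->
  nbhs (0 : S) (split_nbhs n m p c).
Proof.
move=> p0 p1 c0 hp; set a := grid_alpha g n; set e := grid_eps g m.
move=> /andP[na0 na1].
have e0 : 0 < e by exact: grid_eps_gt0.
(* The exponent loses at most [2 * d] to the gap between consecutive levels and less than [d] to
   [grid_eps g m']; both fit into [e]. *)
have [d d0 de] : exists2 d, 0 < d & e = 4 * d.
  by exists (e / 4); rewrite ?divr_gt0// mulrC divfK.
have [m' m'd] := grid_eps_lt d0.
have [idx [idx0 hidx]] : exists idx : nat -> nat, idx 0%N = n /\
    forall i, a - i%:R * d <= grid_alpha g (idx i) <= a /\
      grid_alpha g (idx i) <= a - i%:R * d + d.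
  have /choice[idx hidx] : forall i, exists n',
     a - i.+1%:R * d < grid_alpha g n' < a - i%:R * d.
    by move=> i; apply: grid_between; rewrite -(natr1 i) ltrD2l ltrN2 mulrDl mul1r ltrDl.
  exists (fun i => if i is i'.+1 then idx i' else n); split=> // -[|i].
    by rewrite mul0r subr0 lexx lerDl ltW.
  have /andP[/ltW h1 /ltW h2] := hidx i.
  rewrite h1/= (le_trans h2) ?gerBl ?mulr_ge0 ?(ltW d0)//; split=> //.
  by apply: le_trans h2 _; rewrite -natr1; lra.
pose b i := grid_alpha g (idx i).
have b0 : b 0%N = a by rewrite /b idx0.
have ba i : b i <= a by have [/andP[]] := hidx i.
have bS i : b i - b i.+1 <= 2 * d.
  have [_ h] := hidx i; have [/andP[h' _] _] := hidx i.+1.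
  by move: h h'; rewrite -(natr1 i) /b; lra.
have slope i : (0 <= nu (b i))%E -> fine (nu (b i)) <= fine (nu a) - p * (a - b i).
  by move=> h; rewrite lerBrDr; apply: profile_slope hp _ h na1.
have fa1 : fine (nu a) < 1 by rewrite -lte_fin fineK ?profile_fin.
(* Once [b N <= a - 1 / p], a finite value there would be at most nu(a) - 1 < 0. The summand 1 in
   the choice of [N] compensates the [+ d] in [hidx]. *)
have [N hN] : exists N, nu (b N) = -oo%E.
  exists (Num.bound (1 + 1 / p / d)).
  set N := Num.bound _.
  have [//|nb] := profile_val nu (b N); exfalso.
  have {}nb : (0 <= nu (b N))%E by case/andP: nb.
  have f0 : 0 <= fine (nu (b N)) by apply: fine_ge0.
  have hb : b N <= a - 1 / p.
    have [_ h] := hidx N; rewrite /b; apply: le_trans h _.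
    have : (1 + 1 / p / d) * d <= N%:R * d.
      apply: ler_wpM2r; first exact: ltW.
      have h0 : 0 <= 1 + 1 / p / d by rewrite addr_ge0// !divr_ge0// ltW.
      exact: ltW (archi_boundP h0).
    rewrite mulrDl divfK ?gt_eqF//; lra.
  have : p * (1 / p) <= p * (a - b N) by apply: ler_wpM2l; [exact: ltW|lra].
  rewrite mulrC divfK ?gt_eqF//; have := slope _ nb; lra.
(* The [N] levels contribute [eta] each, which adds up to at most [c]; [N.+1] keeps the divisor
   positive. *)
have [eta eta0 etaN] : exists2 eta, 0 < eta & eta * N.+1%:R = c.
  by exists (c / N.+1%:R); rewrite ?divr_gt0// divfK// pnatr_eq0.
have etac : eta <= c by rewrite -etaN ler_peMr ?ler1n// ltW.
have hball : \forall x \near (0 : S), forall i : 'I_N.+1, gball (idx i, m') eta x.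
  apply: (@filter_forall S _ (fun i : 'I_N.+1 => gball (idx i, m') eta)
    (nbhs (0 : S)) (nbhs_filter (0 : S))).
  by move=> i; exact: nbhs0_gball.
apply: filterS hball => x hx j _; rewrite -/a -/e.
have {}hx i : (i <= N)%N ->
    (count_ge (Sval x) j (eta * 2 `^ (- (b i * j%:R))))%:R <=
    eta * pow2e (nu (b i) + (grid_eps g m')%:E)%E j.
  rewrite -ltnS => iN; have := hx (Ordinal iN); rewrite /gball/= => h.
  exact: dist0_lt_count h j.
rewrite -b0; apply: (split_ball_levels p0 (ltW eta0) etac (N := N)
  (w := fun i => eta * pow2e (nu (b i) + (grid_eps g m')%:E)%E j)).
- apply/count_ge_eq0P; have := hx N (leqnn N).
  by rewrite hN pow2eNy mulr0 lern0 => /eqP.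
- by move=> i; apply: hx; exact: ltnW.
rewrite b0.
have hi (i : 'I_N) : eta * pow2e (nu (b i) + (grid_eps g m')%:E)%E j *
    (eta * 2 `^ (- (b i.+1 * j%:R))) `^ p <=
    eta * (pow2e (nu a + e%:E) j * (c * 2 `^ (- (a * j%:R))) `^ p).
  rewrite -mulrA; apply: ler_wpM2l; first exact: ltW.
  rewrite (powRM _ (ltW eta0) (powR_ge0 _ _)) (powRM _ (ltW c0) (powR_ge0 _ _)).
  rewrite (mulrCA (pow2e _ _)) [leRHS]mulrCA.
  apply: ler_pM.
  - exact: powR_ge0.
  - by rewrite mulr_ge0 ?powR_ge0 ?pow2e_ge0.
  - by apply: ge0_ler_powR; rewrite ?nnegrE ?(ltW eta0) ?(ltW c0) ?(ltW p0).
  have [nb|/andP[nb _]] := profile_val nu (b i).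
    by rewrite nb pow2eNy mul0r mulr_ge0 ?powR_ge0 ?pow2e_ge0.
  rewrite (pow2e_profile _ _ nb) (pow2e_profile _ _ na0).
  rewrite -!powRrM -!pow2D ler_powR ?ler1n//.
  have -> : - (b i.+1 * j%:R) * p = - (b i.+1 * p) * j%:R by ring.
  have -> : - (a * j%:R) * p = - (a * p) * j%:R by ring.
  rewrite -!mulrDl; apply: ler_wpM2r => //.
  have := slope _ nb; have : p * (b i - b i.+1) <= 1 * (2 * d).
    apply: (@le_trans _ _ (p * (2 * d))).
      by apply: ler_wpM2l; [exact: ltW|exact: bS].
    by apply: ler_wpM2r => //; rewrite mulr_ge0// ltW.
  rewrite de; move: m'd; rewrite !mulrBr; lra.
apply: le_trans; first by apply: ler_sum => i _; exact: hi.
rewrite sumr_const card_ord -[leRHS]mulrA -mulrnAl; apply: ler_wpM2r.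
  by rewrite mulr_ge0 ?pow2e_ge0 ?powR_ge0.
by rewrite -etaN -mulr_natr ler_wpM2l ?ler_nat// ltW.
Qed.

(* For [nu alpha = 1] only the first scales matter: there are [2^j] coefficients
   at the scale [j], which is at most [C 2^((1 + eps) j)] for large [j]. *)
Lemma gball_full n m p r : 0 < p -> p <= 1 -> 0 < r ->
  nu (grid_alpha g n) = 1%E ->
  exists K : set S, [/\ nbhs 0 K, abs_pconvex_set p K & K `<=` gball (n, m) r].
Proof.
move=> p0 p1 r0; set a := grid_alpha g n; set e := grid_eps g m => na.
have e0 : 0 < e by exact: grid_eps_gt0.
(* From the scale [J] on, even all 2^j coefficients together respect the count for the constant
   [r / 2]. *)
have [J _ hJ] : \forall j \near \oo, 2 / r <= 2 `^ (e * j%:R) by exact: near_pow2_ge.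
have pE j : pow2e (nu a + e%:E) j = 2 `^ ((1 + e) * j%:R) by rewrite na pow2eE.
exists [set x : S | forall j, [set j | (j < J)%N] j ->
  split_ball p j (r / 4 * 2 `^ (- (a * j%:R))) 0 (Sval x)]; split.
(* The second term makes the allowed count at most 1/2 on the scales below [J], hence 0; the first
   keeps the coefficients within the sup-norm bound. *)
- pose eta := Num.min (r / 4) (2 `^ (- ((1 + e) * J%:R)) / 2).
  have eta0 : 0 < eta by rewrite lt_min !divr_gt0 ?powR_gt0.
  apply: filterS (nbhs0_gball (n, m) eta0) => x /dist0_lt_count hx j /= jJ.
  apply: split_ball_sup => // k; apply: (@le_trans _ _ (eta * 2 `^ (- (a * j%:R)))).
    apply/ltW; apply: (count_ge_eq0P _ _ _).1 k; apply/eqP.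
    rewrite -leqn0 -ltnS -(ltr_nat R); apply: le_lt_trans (hx j) _.
    rewrite /= -/a -/e pE; apply: (@le_lt_trans _ _
        (2 `^ (- ((1 + e) * J%:R)) / 2 * 2 `^ ((1 + e) * J%:R))).
      apply: ler_pM; rewrite ?(ltW eta0) ?powR_ge0 ?ge_min ?lexx ?orbT//.
      by rewrite ler_powR ?ler1n// ler_wpM2l ?ler_nat ?(ltnW jJ)// addr_ge0// ltW.
    by rewrite mulrAC -pow2D addNr powRr0 mul1r invf_lt1 ?ltr1n.
  by apply: ler_wpM2r; rewrite ?powR_ge0// ge_min lexx.
- exact: (split_ball_abs_pconvex [set j | (j < J)%N]
    (fun j => r / 4 * 2 `^ (- (a * j%:R))) (fun=> 0)).
move=> x hx; rewrite /gball/= -/a -/e.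
apply: (@le_lt_trans _ _ (r / 2)%:E); last by rewrite lte_fin; lra.
apply: dist0_le => [|j]; first by rewrite divr_ge0// ltW.
rewrite pE; have [Jj|jJ] := leqP J j.
  apply: (@le_trans _ _ (2 `^ j%:R)).
    rewrite powR_mulrn// -natrX ler_nat; apply: leq_trans (max_card _) _.
    by rewrite card_ord.
  rewrite mulrDl mul1r pow2D mulrCA ler_peMr ?powR_ge0//.
  have := hJ j Jj; rewrite /= ler_pdivrMr//; lra.
have u0 : 0 < r / 4 * 2 `^ (- (a * j%:R)) by rewrite mulr_gt0 ?divr_gt0// powR_gt0.
have := split_ball_chebyshev p0 u0 (hx j jJ).
rewrite pmulr_lle0 ?powR_gt0// mulrA (_ : 2 * (r / 4) = r / 2); last by lra.
move=> /le_trans; apply; rewrite mulr_ge0 ?powR_ge0//; lra.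
Qed.

Lemma gball_pconvex n m p r : 0 < p -> p <= 1 -> 0 < r ->
  (forall a, (0 <= nu a < 1)%E -> (p%:E <= right_inf_derivative nu a)%E) ->
  exists K : set S, [/\ nbhs 0 K, abs_pconvex_set p K & K `<=` gball (n, m) r].
Proof.
move=> p0 p1 r0 hp; have c0 : 0 < r / 4 by rewrite divr_gt0.
pose K := split_nbhs n m p (r / 4).
have pK : abs_pconvex_set p K by exact: (split_ball_abs_pconvex setT
    (fun j => r / 4 * 2 `^ (- (grid_alpha g n * j%:R))) (fun j => _)).
have rK : K `<=` gball (n, m) r by apply: split_nbhs_gball => //; lra.
have [na|/andP[na0 na1]] := profile_val nu (grid_alpha g n).
  by exists K; split => //; exact: nbhs0_split_nbhs_Ny.
have [|na] := ltP (nu (grid_alpha g n)) 1%E; last first.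
  by apply: gball_full => //; apply/eqP; rewrite eq_le na1.
by exists K; split => //; apply: nbhs0_split_nbhs_fin => //; rewrite na0.
Qed.

Lemma locally_pconvex_of_slope p : 0 < p -> p <= 1 ->
  (forall a, (0 <= nu a < 1)%E -> (p%:E <= right_inf_derivative nu a)%E) ->
  locally_pconvex S p.
Proof.
move=> p0 p1 hp U /nbhs0_gballP[s [r [r0 sU]]].
suff [K [K0 pK Ks]] : exists K : set S, [/\ nbhs 0 K, abs_pconvex_set p K &
    forall x, K x -> forall nm, nm \in s -> gball nm r x].
  by exists K; split => // x /Ks/sU.
elim: s {sU} => [|[n m] s [K [K0 pK Ks]]].
  by exists setT; split => //; exact: filterT.
have [L [L0 pL Lr]] := gball_pconvex n m p0 p1 r0 hp.
exists (K `&` L); split; first exact: filterI.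
- split=> [N theta x hx th0 th1|l x [Kx Lx] l1].
    by split; [apply: pK.1|apply: pL.1] => // i; case: (hx i).
  by split; [apply: pK.2|apply: pL.2].
move=> x [Kx Lx] nm; rewrite inE => /predU1P[->|nms]; first exact: Lr.
exact: Ks.
Qed.

End local_convexity.

(** * Sequences supported on one block of indices *)

Section blocks.
Context {R : realType}.
Implicit Types (p c t a r : R) (b : \bar R) (i j n A M : nat).

(** The quotient by [A] numbers the runs of [A] consecutive indices, so distinct [n] give disjoint
    supports. *)
Definition block j A c n : Omega R :=
  fun l => if (projT1 l == j) && (projT2 l %/ A == n)%N then c%:C else 0.

Lemma cnorm_block j A c n i (k : 'I_(2 ^ i)) : 0 <= c ->
  cnorm (block j A c n (existT _ i k)) =
  if (i == j) && (k %/ A == n)%N then c else 0.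
Proof. by move=> c0; rewrite /block/=; case: ifP; rewrite ?cnorm0 ?cnorm_real. Qed.

Lemma count_block_eq0 j A c n i t : 0 <= c -> 0 < t -> (i != j) || (c < t) ->
  count_ge (block j A c n) i t = 0%N.
Proof.
move=> c0 t0 ijc; apply/count_ge_eq0P => k; rewrite cnorm_block//.
by move: ijc; case: (i == j) => //= ct; case: ifP.
Qed.

(** Within one block the quotient by [A] is fixed, so the remainder modulo [A] is injective. *)
Lemma count_block_le j A c n i t : (0 < A)%N -> 0 <= c -> 0 < t ->
  (count_ge (block j A c n) i t <= A)%N.
Proof.
move=> A0 c0 t0.
pose f (k : 'I_(2 ^ i)) : 'I_A := Ordinal (ltn_pmod k A0).
rewrite -[leqRHS]card_ord; apply: (@leq_card_in _ _ f) => k l.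
have h (q : 'I_(2 ^ i)) : q \in [pred k : 'I_(2 ^ i) |
    t%:C <= `|block j A c n (existT _ i k)|] -> (q %/ A = n)%N.
  rewrite !inE in_count_ge cnorm_block//.
  by case: ifP => [/andP[_ /eqP]//|_]; rewrite leNgt t0.
move=> /h kn /h ln [kl]; apply/val_inj => /=.
by rewrite (divn_eq k A) (divn_eq l A) kn ln kl.
Qed.

Lemma Sset_block (nu : R -> \bar R) j A c n : 0 <= c ->
  Sset nu (block j A c n).
Proof.
move=> c0 a; apply/asymptotic_profile_leP => w _; exists 1 => //.
exists j.+1 => // i /= ji; rewrite count_block_eq0 ?powR_ge0 ?powR_gt0//.
by rewrite gtn_eqF.
Qed.

Lemma dist0_block j A c n a b r : (0 < A)%N -> 0 <= c -> 0 < r ->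
  c < r * 2 `^ (- (a * j%:R)) \/ A%:R <= r * pow2e b j ->
  (dist0 a b (block j A c n) <= r%:E)%E.
Proof.
move=> A0 c0 r0 h; apply: dist0_le => [|i]; first exact: ltW.
have t0 : 0 < r * 2 `^ (- (a * i%:R)) by rewrite mulr_gt0// powR_gt0.
have ge0 : 0 <= r * pow2e b i by rewrite mulr_ge0 ?pow2e_ge0// ltW.
have [ij|ij] := eqVneq i j; last by rewrite count_block_eq0 ?ij.
case: h => [cr|]; first by rewrite count_block_eq0// ij cr orbT.
by rewrite -ij; apply: le_trans; rewrite ler_nat count_block_le.
Qed.

(** Each of the first [A * M] indices lies in exactly one of the [M] blocks, so the sum takes the
    value [theta * c] there. *)
Lemma count_block_sum j A c M t theta : (A * M <= 2 ^ j)%N -> 0 <= c ->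
  0 <= theta -> t <= theta * c ->
  (A * M <= count_ge (\sum_(n < M) theta%:C *: block j A c n)%R j t)%N.
Proof.
move=> AM c0 th0 tc; pose f (k : 'I_(A * M)) : 'I_(2 ^ j) := widen_ord AM k.
have finj : injective f by move=> k l [kl]; apply/val_inj.
rewrite -[leqLHS]card_ord -(fintype.card_image finj); apply: subset_leq_card.
apply/fintype.subsetP => l /fintype.imageP[k _ ->{l}]; rewrite !inE in_count_ge.
have kM : (k %/ A < M)%N.
  have := leq_ltn_trans (leq0n _) (ltn_ord k); rewrite muln_gt0 => /andP[A0 _].
  by rewrite ltn_divLR// (leq_trans (ltn_ord k))// mulnC.
rewrite fct_sumE (bigD1 (Ordinal kM))//= big1 => [|n nk].
  by rewrite addr0 /GRing.scale/= cnormM cnorm_block// !eqxx/= cnorm_real.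
rewrite -[LHS]/(theta%:C * block j A c n (existT _ j (f k))) /block/= eqxx/=.
rewrite ifF ?mulr0//; apply: contra_neqF nk => /eqP kn; exact/val_inj.
Qed.

End blocks.

(** * Failure of local convexity above the critical exponent *)

Section no_local_convexity.
Context {R : realType} {nu : profile R} {g : grid R}.
Local Notation S := (Sspace nu g).
Implicit Types (p c t a h r x : R) (n m j A M : nat).

Lemma floor_ge_half x : 1 <= x ->
  exists A, [/\ (0 < A)%N, A%:R <= x & x <= 2 * A%:R].
Proof.
move=> x1; have /andP[h1 h2] := truncn_itv (le_trans ler01 x1).
have A0 : (0 < Num.truncn x)%N by rewrite -ltnS -(ltr_nat R) (le_lt_trans x1).
exists (Num.truncn x); split=> //; apply: le_trans (ltW h2) _.
by rewrite -natrM ler_nat mul2n -addnn -addn1 leq_add2l.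
Qed.

Lemma Sset_block_in j A c n : 0 <= c -> block j A c n \in Spred nu.
Proof. by move=> c0; apply/mem_set; exact: Sset_block. Qed.

Definition Sblock j A c (c0 : 0 <= c) n : S := MkS g (Sset_block_in j A n c0).

(** If alpha_n < a, the value 2^(-a j) eventually falls below the threshold. Otherwise nu(alpha_n)
    >= nu(a), and the margin eps_m eventually absorbs the constant [r / 2]. *)
Lemma gball_Sblock a nm r : (0 <= nu a)%E -> 0 < r ->
  \forall j \near \oo, forall A n, (0 < A)%N ->
    A%:R <= 2 `^ (fine (nu a) * j%:R) ->
    gball nm r (Sblock j A (powR_ge0 2 (- (a * j%:R))) n).
Proof.
move=> na r0; case: nm => n m; set b := grid_alpha g n; set e := grid_eps g m.
have e0 : 0 < e by exact: grid_eps_gt0.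
have r20 : 0 < r / 2 by rewrite divr_gt0.
suff : \forall j \near \oo, 2 `^ (- (a * j%:R)) < r / 2 * 2 `^ (- (b * j%:R)) \/
    2 `^ (fine (nu a) * j%:R) <= r / 2 * pow2e (nu b + e%:E) j.
  apply: filterS => j h A k A0 Aj; rewrite /gball/=.
  apply: (@le_lt_trans _ _ (r / 2)%:E); last by rewrite lte_fin; lra.
  apply: dist0_block => //.
  by case: h => h; [left|right; apply: le_trans h].
have [ba|ab] := ltP b a.
  have := @near_pow2_ge R (1 + 2 / r) (a - b).
  rewrite subr_gt0 => /(_ ba); apply: filterS => j h; left.
  rewrite (_ : - (b * j%:R) = (a - b) * j%:R + - (a * j%:R)); last by ring.
  rewrite pow2D mulrA ltr_pMl ?powR_gt0//.
  rewrite -(@ltr_pM2l _ (2 / r)) ?divr_gt0// mulr1 mulrA.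
  rewrite (_ : 2 / r * (r / 2) = 1) ?mul1r; last by field; rewrite gt_eqF.
  by apply: lt_le_trans h; rewrite ltrDr.
have nb := profile_ge0_homo na ab.
have := near_pow2_ge (2 / r) e0; apply: filterS => j h; right.
rewrite pow2e_profile// mulrDl pow2D.
rewrite mulrCA; apply: (@le_trans _ _ (2 `^ (fine (nu b) * j%:R))).
  by rewrite ler_powR ?ler1n// ler_wpM2r// fine_profile_homo.
rewrite ler_peMr ?powR_ge0//.
by move: h; rewrite ler_pdivrMr//; lra.
Qed.

Lemma not_locally_pconvex p a : p <= 1 -> (0 <= nu a < 1)%E ->
  (right_inf_derivative nu a < p%:E)%E -> ~ locally_pconvex S p.
Proof.
move=> p1 /andP[na0 na1] hp; set v := fine (nu a).
have v0 : 0 <= v by exact: fine_ge0.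
have v1 : v < 1 by rewrite -lte_fin /v fineK ?profile_fin.
have v10 : 0 < 1 - v by rewrite subr_gt0.
(* Requiring [h < 1 - v] gives [v + p * h <= 1], so that the blocks fit into the scale. *)
have [h /andP[h0 hv] nuh] := right_inf_derivative_lt na0 v10 hp.
have na_h : (0 <= nu (a + h)%R)%E by apply: profile_ge0_homo na0 _; rewrite lerDl ltW.
have ph0 : 0 < p * h.
  have := @fine_profile_homo R nu a (a + h) na0.
  by rewrite lerDl ltW// => /(_ isT); move: nuh; lra.
have p0 : 0 < p by move: ph0; rewrite pmulr_lgt0.
have phv : p * h <= 1 - v by apply: le_trans (ltW hv); rewrite ler_piMl// ltW.
(* Right-continuity at [a + h] carries the strict inequality to a grid point slightly to the
   right. *)
have [n /andP[ahn nun]] : exists n, (a + h < grid_alpha g n) &&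
    (nu (grid_alpha g n) < (v + p * h)%:E)%E.
  have : nbhs (nu (a + h)) [set y | (y < (v + p * h)%:E)%E].
    apply: open_nbhs_nbhs; split; first exact: open_ereal_lt_ereal.
    by rewrite /= -(fineK (profile_fin na_h)) lte_fin.
  move=> /(@profile_rcont R nu (a + h))[d /= d0 hd].
  have [n /andP[n1 n2]] := @grid_between R g (a + h) (a + h + d) ltac:(by rewrite ltrDl).
  exists n; rewrite n1/=; apply: hd => //=.
  by rewrite distrC gtr0_norm ?subr_gt0// ltrBlDl.
pose w := fine (nu (grid_alpha g n)).
have nn : (0 <= nu (grid_alpha g n))%E by apply: profile_ge0_homo na_h (ltW ahn).
have w0 : 0 < v + p * h - w.
  by rewrite subr_gt0 -lte_fin /w fineK ?profile_fin.
have [m me] := grid_eps_lt (g := g) w0; set e := grid_eps g m in me.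
move=> /(_ _ (nbhs0_gball (n, m) (@ltr01 R)))[K [K0 [pK _] KU]].
have [s [r [r0 sK]]] := nbhs0_gballP K0.
have hs : \forall j \near \oo, forall nm, nm \in s -> forall A i, (0 < A)%N ->
    A%:R <= 2 `^ (v * j%:R) ->
    gball nm r (Sblock j A (powR_ge0 2 (- (a * j%:R))) i).
  elim: s {sK} => [|nm s IH]; first exact: nearW.
  have := gball_Sblock nm na0 r0; apply: filterS2 IH => j IH h' nm'.
  by rewrite inE => /predU1P[->|/IH].
(* Rounding [A] and [M] to integers costs a factor 2 each; a constant above 4 keeps the final
   contradiction strict. *)
have he : \forall j \near \oo, 5 <= 2 `^ ((v + p * h - (w + e)) * j%:R) :> R.
  by apply: near_pow2_ge; rewrite subr_gt0 -ltrBrDl.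
have [j [hsj hej]] : exists j, (forall nm, nm \in s -> forall A i, (0 < A)%N ->
    A%:R <= 2 `^ (v * j%:R) ->
    gball nm r (Sblock j A (powR_ge0 2 (- (a * j%:R))) i)) /\
    5 <= 2 `^ ((v + p * h - (w + e)) * j%:R) :> R.
  by apply: (@filter_ex _ (\oo : set_system nat)); exact: filterS2 hs he.
have ge1 u : 0 <= u -> 1 <= 2 `^ (u * j%:R) :> R.
  by move=> u0; rewrite -[leLHS](powRr0 (2 : R)) ler_powR ?ler1n// mulr_ge0.
have [A [A0 AR RA]] := floor_ge_half (ge1 _ v0).
have [M [M0 MR RM]] := floor_ge_half (ge1 _ (ltW ph0)).
pose c : R := 2 `^ (- (a * j%:R)); have c0 : 0 <= c by exact: powR_ge0.
pose theta : R := M%:R `^ (- p^-1).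
have theta0 : 0 <= theta by exact: powR_ge0.
have AM : (A * M <= 2 ^ j)%N.
  rewrite -(ler_nat R) natrM natrX -powR_mulrn//.
  apply: (@le_trans _ _ (2 `^ (v * j%:R) * 2 `^ (p * h * j%:R))).
    by apply: ler_pM.
  by rewrite -pow2D -mulrDl ler_powR ?ler1n// ler_piMl//; lra.
have thM : \sum_(i < M) theta `^ p = 1.
  rewrite sumr_const card_ord -powRrM mulNr mulVf ?gt_eqF// powR_inv1 ?ler0n//.
  by rewrite -[LHS]mulr_natl divff// pnatr_eq0 -lt0n.
(* As M <= 2^(p h j), the weight M^(-1/p) is at least 2^(-h j), and alpha_n exceeds [a + h]. *)
have thc : 1 * 2 `^ (- (grid_alpha g n * j%:R)) <= theta * c.
  rewrite mul1r; apply: (@le_trans _ _ (2 `^ (- (h * j%:R)) * c)).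
    rewrite -pow2D ler_powR ?ler1n// -opprD lerN2 -mulrDl ler_wpM2r//.
    by rewrite addrC ltW.
  apply: ler_wpM2r => //; rewrite /theta powRN powRN lef_pV2 ?posrE ?powR_gt0 ?ltr0n//.
  rewrite (_ : h * j%:R = p * h * j%:R * p^-1); last first.
    by field; rewrite gt_eqF.
  by rewrite powRrM; apply: ge0_ler_powR; rewrite ?nnegrE ?invr_ge0 ?powR_ge0 ?(ltW p0).
have := KU _ (pK M (fun=> theta) (fun i => Sblock j A c0 i) _ _ thM).
have Kb i : K (Sblock j A c0 i) by apply: sK => nm nms; exact: hsj.
move=> /(_ (fun i => Kb i) (fun=> theta0)); rewrite /gball/=.
rewrite (_ : Sval _ = \sum_(i < M) theta%:C *: block j A c i); last first.
  by rewrite -[LHS]/(val _) raddf_sum; apply: eq_bigr => i _; exact: SvalZ.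
move=> /dist0_lt_count/(_ j); rewrite -/e mul1r.
have := count_block_sum AM c0 theta0 thc; rewrite mul1r -(ler_nat R).
move=> /le_trans/[apply].
rewrite pow2e_profile// -/w.
apply/negP; rewrite -ltNge natrM.
rewrite -(@ltr_pM2l _ 4)//.
apply: (@lt_le_trans _ _ (2 `^ (v * j%:R) * 2 `^ (p * h * j%:R))); last first.
  rewrite (_ : 4 * _ = (2 * A%:R) * (2 * M%:R)); last by ring.
  by apply: ler_pM; rewrite ?powR_ge0.
rewrite -pow2D -mulrDl.
rewrite mul1r (_ : (v + p * h) * j%:R =
  (v + p * h - (w + e)) * j%:R + (w + e) * j%:R); last by ring.
rewrite pow2D ltr_pM2r ?powR_gt0//; apply: lt_le_trans hej; by rewrite ltr_nat.
Qed.

End no_local_convexity.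

Theorem theorem1 (R : realType) (nu : profile R) (g : grid R) :
  let p0 := critical_exponent nu in
  (0 < p0 -> locally_pconvex (Sspace nu g) p0) /\
  (p0 < 1 -> forall p : R, p0 < p -> p <= 1 ->
     ~ locally_pconvex (Sspace nu g) p).
Proof.
move=> p0; split=> [p0_gt0|p0_lt1 p p0p p1].
  apply: locally_pconvex_of_slope => // [|a na].
    exact: critical_exponent_le1.
  exact: right_inf_derivative_ge_critical.
have [a na ap] := right_inf_derivative_lt_critical p0p p1.
exact: not_locally_pconvex p1 na ap.
Qed.
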